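(* Let $q\equiv 3 \pmod 4$ be a prime power, let $P=\{(x,y,z)\in\mathbb{F}_q^3 : z=x^2+y^2\}$, and let $A$ be a multiplicative subgroup of $\mathbb{F}_q^*$ with $|A|\ge q^{2/3}$. For any $0<\delta\le 1$ there exists an integer $q_0=q_0(\delta)$ with the following property: if $q\ge q_0$ and $X\subset P$ satisfies $|X|\ge \delta q^2$, then the number of non-trivial energy tuples $(a,b,c,d)\in X^4$ whose corresponding rectangles have side-lengths in $A$ is at least $c\,\frac{|X|^4|A|^2}{q^5}$, where $c>0$ is an absolute constant.
   Context: Every point of $P$ is written as $x=(\underline{x},\underline{x}\cdot\underline{x})$ with $\underline{x}\in\mathbb{F}_q^2$, where $u\cdot v=u_1v_1+u_2v_2$. A tuple $(a,b,c,d)\in X^4$ is a non-trivial energy tuple if $a+b=c+d$ and $a,b,c,d$ are pairwise distinct. Four points $x,z,y,t\in\mathbb{F}_q^2$ form a rectangle (vertices in cyclic order $x,z,y,t$) if $(x-z)\cdot(y-z)=0$, $(z-y)\cdot(t-y)=0$, $(y-t)\cdot(x-t)=0$, $(t-x)\cdot(z-x)=0$; the corresponding rectangle of an energy tuple $(a,b,c,d)$ is the rectangle with vertices $\underline{a},\underline{c},\underline{b},\underline{d}$, and the length of a side $uv$ is $(u-v)\cdot(u-v)$. *)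

(* Defs.v *)
From HB Require Import structures.
From mathcomp Require Import all_boot all_order all_algebra all_fingroup all_field.
From Stdlib Require Import Reals.
Set Implicit Arguments. Unset Strict Implicit. Unset Printing Implicit Defensive.
Import GRing.Theory.
Local Open Scope ring_scope.

Section Defs.
Variable F : finFieldType.

Definition pt := (F * F * F)%type.

Definition paraboloid : {set pt} :=
  [set x : pt | x.2 == x.1.1 ^+ 2 + x.1.2 ^+ 2].

Definition base (x : pt) : F * F := x.1.

Definition dot2 (u v : F * F) : F := u.1 * v.1 + u.2 * v.2.
Definition sub2 (u v : F * F) : F * F := (u.1 - v.1, u.2 - v.2).
Definition len2 (u v : F * F) : F := dot2 (sub2 u v) (sub2 u v).

Definition add3 (x y : pt) : pt := (x.1.1 + y.1.1, x.1.2 + y.1.2, x.2 + y.2).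

(* x, z, y, t form a rectangle, vertices in cyclic order x, z, y, t *)
Definition is_rectangle (x z y t : F * F) : bool :=
  [&& dot2 (sub2 x z) (sub2 y z) == 0, dot2 (sub2 z y) (sub2 t y) == 0,
      dot2 (sub2 y t) (sub2 x t) == 0 & dot2 (sub2 t x) (sub2 z x) == 0].

Definition nontrivial_energy (X : {set pt}) (a b c d : pt) : bool :=
  [&& a \in X, b \in X, c \in X, d \in X, add3 a b == add3 c d &
      [&& a != b, a != c, a != d, b != c, b != d & c != d]].

Definition in_subgroup (A : {group {unit F}}) (l : F) : bool :=
  [exists u in A, val u == l].

Definition rect_sides_in (A : {group {unit F}}) (a b c d : pt) : bool :=
  let a' := base a in let b' := base b in let c' := base c in let d' := base d in
  [&& is_rectangle a' c' b' d',
      in_subgroup A (len2 a' c'), in_subgroup A (len2 c' b'),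
      in_subgroup A (len2 b' d') & in_subgroup A (len2 d' a')].

Definition count_rect_energy (X : {set pt}) (A : {group {unit F}}) : nat :=
  #|[set t : pt * pt * pt * pt |
      nontrivial_energy X t.1.1.1 t.1.1.2 t.1.2 t.2 &&
      rect_sides_in A t.1.1.1 t.1.1.2 t.1.2 t.2]|.
End Defs.

(* Main.v *)
(** On the paraboloid, a + b = c + d says exactly that the projections of
a, c, b, d form a rectangle. Fix a point e of the unit circle and let e' be e
turned by a right angle; in the coordinates of the basis (e, e') the side
lengths of an axis-parallel rectangle are squares, so its sides have length in
A as soon as the coordinate differences lie in A. It therefore suffices to
count, for each of the at least q/2 directions e, the rectangles
{x, x'} * {y, y'} of a dense subset of the grid F * F with x' - x and y' - y
in A.

The Cayley graph of (F, +) generated by A is pseudorandom: every set G of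
vertices spans at least |A| |G|^2 / q - sqrt(q) |G| edges. Because A is
invariant under dilation by its elements, each edge yields |A| incidences
between the points A * G and the lines with slope in A and intercept in G, and
the bound is Vinh's point-line incidence estimate, which follows from the
second moment of the number of lines through a point. Applying this bound
first to the columns of the grid set and then to the common part of two
columns, with Cauchy-Schwarz each time, gives the expected number of
rectangles up to a constant once |A| is much larger than sqrt(q); this is
where |A| >= q^(2/3) and the size of q enter. *)
Require Import Defs.
From mathcomp Require Import all_boot all_order all_algebra all_fingroup all_solvable all_field.
From mathcomp Require Import ring lra zify.

Set Implicit Arguments.
Unset Strict Implicit.
Unset Printing Implicit Defensive.

(** * Cauchy-Schwarz for finite sums *)

Section CauchySchwarz.
Import Order.TTheory GRing.Theory Num.Theory.
Local Open Scope ring_scope.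
Variable K : realFieldType.

Lemma sqr_sum_le (T : finType) (P : {set T}) (f : T -> K) :
  (\sum_(x in P) f x) ^+ 2 <= #|P|%:R * \sum_(x in P) f x ^+ 2.
Proof.
have [->|P0] := eqVneq P set0; first by rewrite !big_set0 mulr0 expr0n.
set s := \sum_(x in P) f x; set n : K := #|P|%:R.
have n_gt0 : 0 < n by rewrite ltr0n card_gt0.
(* Expanded, this sum is [n] times the difference of the two sides of the claim. *)
have : 0 <= \sum_(x in P) (n * f x - s) ^+ 2 by apply: sumr_ge0 => x _; rewrite sqr_ge0.
have -> : \sum_(x in P) (n * f x - s) ^+ 2 =
    \sum_(x in P) (n ^+ 2 * f x ^+ 2 + ((- 2 * n * s) * f x + s ^+ 2)).
  by apply: eq_bigr => x _; ring.
rewrite 2!big_split -2!mulr_sumr /= -/s sumr_const -mulr_natr -/n => H.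
rewrite -subr_ge0 -(pmulr_rge0 _ n_gt0); apply: le_trans H _.
by rewrite le_eqVlt; apply/orP; left; apply/eqP; ring.
Qed.

End CauchySchwarz.

(** * Second moment of point-line incidences *)

Section Incidences.
Import Order.TTheory GRing.Theory Num.Theory.
Local Open Scope ring_scope.
Variable F : finFieldType.
Local Notation q := #|F|.

(* The pair [l] stands for the line of slope [l.1] and intercept [l.2]. *)
Definition incident (l p : F * F) : bool := p.2 == l.1 * p.1 + l.2.

Definition richness (L : {set F * F}) (p : F * F) : nat :=
  (\sum_(l in L) incident l p)%N.

Lemma card_line (l : F * F) : (\sum_p incident l p)%N = q.
Proof.
rewrite -big_mkcond /= sum1_card.
rewrite -(card_imset (f := fun x => (x, l.1 * x + l.2)) predT); last by move=> x y [].
apply: eq_card => -[x y]; rewrite unfold_in /incident /=.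
by apply/eqP/imsetP => [->|[z _ [-> ->]]]; [exists x|].
Qed.

Lemma card_meet (l l' : F * F) :
  l != l' -> (\sum_p incident l p * incident l' p <= 1)%N.
Proof.
move=> ll'; under eq_bigr do rewrite mulnb.
rewrite -big_mkcond sum1_card.
apply/card_le1_eqP => -[x y] [x' y']; rewrite !unfold_in /incident /=.
case: l l' ll' => [b c] [b' c'] /= ll'.
move=> /andP[/eqP h1 /eqP h2] /andP[/eqP h3 /eqP h4].
have [bb|bb] := eqVneq b b'.
  case/eqP: ll'; congr pair => //; apply: (addrI (b * x)).
  by rewrite -h1 h2 bb.
have xx : x = x'.
  have /eqP : (b - b') * (x - x') = 0.
    have -> : (b - b') * (x - x') =
      (b * x + c) - (b' * x + c') - ((b * x' + c) - (b' * x' + c')) by ring.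
    by rewrite -h1 -h2 -h3 -h4; ring.
  by rewrite mulf_eq0 !subr_eq0 (negPf bb) => /eqP.
by rewrite h1 h3 xx.
Qed.

Lemma sum_richness (L : {set F * F}) : (\sum_p richness L p = #|L| * q)%N.
Proof.
rewrite exchange_big /=; under eq_bigr do rewrite card_line.
by rewrite sum_nat_const.
Qed.

(** The second moment counts pairs of lines through a common point: a line meets itself in q points
    and any other line in at most one. *)
Lemma sum_richness_sqr (L : {set F * F}) :
  (\sum_p richness L p * richness L p <= #|L| * #|L| + #|L| * q)%N.
Proof.
have -> : (\sum_p richness L p * richness L p =
    \sum_(l in L) \sum_(l' in L) \sum_p incident l p * incident l' p)%N.
  under eq_bigr do rewrite big_distrlr /=.
  rewrite exchange_big; apply: eq_bigr => l _.
  by rewrite exchange_big.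
rewrite -2!sum_nat_const -big_split /=; apply: leq_sum => l Ll.
rewrite (bigD1 l) //= addnC leq_add //.
  rewrite -[#|L|]sum1_card (bigD1 l Ll) /=; apply: leq_trans (leq_addl _ _).
  by apply: leq_sum => l' /andP[_ ll']; rewrite card_meet // eq_sym.
by under eq_bigr do rewrite mulnb andbb; rewrite card_line.
Qed.

Variable K : realFieldType.

Lemma card_field_gt0 : 0 < q%:R :> K.
Proof. by rewrite ltr0n; apply/card_gt0P; exists 0. Qed.

(** A point lies on |L| / q lines of [L] on average, and the squared deviations from this mean,
    summed over the whole plane, total at most q |L|. Cauchy-Schwarz over [P] does the rest. *)
Lemma incidence_variance (P L : {set F * F}) :
  ((\sum_(p in P) richness L p)%:R - #|P|%:R * (#|L|%:R / q%:R)) ^+ 2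
    <= q%:R * #|P|%:R * #|L|%:R :> K.
Proof.
have q0 := card_field_gt0.
set mu : K := #|L|%:R / q%:R.
have -> : (\sum_(p in P) richness L p)%:R - #|P|%:R * mu =
    \sum_(p in P) ((richness L p)%:R - mu).
  by rewrite big_split /= sumr_const natr_sum mulr_natl mulNrn.
apply: le_trans (sqr_sum_le _ _) _.
rewrite -mulrA mulrCA; apply: ler_wpM2l; first exact: ler0n.
apply: (@le_trans _ _ (\sum_p ((richness L p)%:R - mu) ^+ 2)).
  rewrite [leRHS](bigID (mem P)) /= lerDl; apply: sumr_ge0 => p _.
  exact: sqr_ge0.
have -> : \sum_p ((richness L p)%:R - mu) ^+ 2 =
    \sum_p ((richness L p * richness L p)%N%:R + ((- 2 * mu) * (richness L p)%:R + mu ^+ 2)).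
  by apply: eq_bigr => x _; rewrite natrM; ring.
rewrite 2!big_split -mulr_sumr /= -2!natr_sum sum_richness sumr_const.
rewrite cardT -cardE card_prod -[_ *+ (_ * _)]mulr_natr natrM.
have : ((\sum_p richness L p * richness L p)%N%:R <= (#|L| * #|L| + #|L| * q)%N%:R :> K).
  by rewrite ler_nat sum_richness_sqr.
rewrite natrD !natrM => H.
apply: (le_trans (lerD H (lexx _))).
rewrite le_eqVlt; apply/orP; left; apply/eqP; rewrite /mu; field.
by rewrite gt_eqF.
Qed.

End Incidences.

(** * Cayley graph of a dilation-invariant set, and rectangles in grid sets *)

Section Cayley.
Import Order.TTheory GRing.Theory Num.Theory.
Local Open Scope ring_scope.
Variable F : finFieldType.
Local Notation q := #|F|.
Variable S : {set F}.
Hypotheses (S0 : 0 \notin S) (S_gt0 : (0 < #|S|)%N).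
Hypothesis SM : forall b s : F, b \in S -> (b * s \in S) = (s \in S).

(** Pairs are ordered, as [S] need not be closed under negation. *)
Definition cayley_pairs (G : {set F}) : nat :=
  (\sum_(x in G) \sum_(x' in G) ((x' - x)%R \in S))%N.

Lemma sum_dilate (b d : F) :
  b \in S -> (\sum_(s in S) (d == b * s)%R)%N = (d \in S).
Proof.
move=> Sb; have b0 : b != 0 by apply: contraNneq S0 => <-.
have -> : d = b * (b^-1 * d) by rewrite mulVKf.
set e := b^-1 * d; rewrite SM //.
under eq_bigr do rewrite (inj_eq (mulfI b0)).
have [Se|Se] := boolP (e \in S).
  rewrite (bigD1 e) //= eqxx big1 // => s /andP[_ /negPf].
  by rewrite eq_sym => ->.
by rewrite big1 // => s Ss; case: eqP => // es; rewrite es Ss in Se.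
Qed.

(* Dilating by [S] turns each pair of the Cayley graph into [#|S|] incidences
   between the points and the lines indexed by [S * G]. *)
Lemma incidences_cayley (G : {set F}) :
  (\sum_(p in setX S G) richness (setX S G) p = #|S| * cayley_pairs G)%N.
Proof.
have sumX (h : F * F -> nat) : (\sum_(p in setX S G) h p =
    \sum_(s in S) \sum_(x in G) h (s, x))%N.
  rewrite pair_big_dep /=; apply: eq_big => [[s x]|[s x] _] //=.
  by rewrite in_setX.
rewrite sumX; under eq_bigr do under eq_bigr do rewrite /richness sumX.
under eq_bigr do rewrite exchange_big.
rewrite exchange_big -sum_nat_const; apply: eq_bigr => b Sb /=.
under eq_bigr do rewrite exchange_big.
rewrite exchange_big; apply: eq_bigr => x Gx /=.
rewrite exchange_big; apply: eq_bigr => x' Gx' /=.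
rewrite -(sum_dilate _ Sb); apply: eq_bigr => s _.
by rewrite /incident /= subr_eq.
Qed.

Variables (K : realFieldType) (r : K).
Hypotheses (r_ge0 : 0 <= r) (q_le : q%:R <= r ^+ 2).

(** Take both points and lines to be S * G in the incidence bound and cancel |S|^2. Here [r] stands
    in for the square root of q, which [K] may lack. *)
Lemma cayley_pairs_ge (G : {set F}) :
  #|S|%:R / q%:R * #|G|%:R ^+ 2 - r * #|G|%:R <= (cayley_pairs G)%:R.
Proof.
have q0 := card_field_gt0 F K.
have := incidence_variance K (setX S G) (setX S G).
rewrite incidences_cayley cardsX !natrM.
have m0 : 0 < #|S|%:R :> K by rewrite ltr0n.
have := ler0n K #|G|.
move: q_le m0 q0 r_ge0; move: (#|S|%:R : K) (q%:R : K) (#|G|%:R : K) ((cayley_pairs G)%:R : K).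
move=> m Q g c hr m0 Q0 r0 g0.
have -> : m * c - m * g * (m * g / Q) = m * (c - m / Q * g ^+ 2).
  by field; rewrite gt_eqF.
have -> : Q * (m * g) * (m * g) = m ^+ 2 * (Q * g ^+ 2) by ring.
rewrite exprMn ler_pM2l ?exprn_gt0 // => h.
have {}h : (c - m / Q * g ^+ 2) ^+ 2 <= (r * g) ^+ 2.
  by apply: le_trans h _; rewrite exprMn ler_wpM2r ?exprn_ge0.
rewrite -subr_ge0; have rg : 0 <= r * g by rewrite mulr_ge0.
move: h; move: (r * g) rg (m / Q * g ^+ 2) => y y0 z h.
rewrite leNgt; apply/negP => lt0; nra.
Qed.

Lemma cayley_edges : (\sum_y \sum_(y' | (y' - y)%R \in S) 1 = q * #|S|)%N.
Proof.
rewrite -[RHS]sum_nat_const; apply: eq_bigr => y _.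
rewrite sum1_card -(card_imset S (addrI y)); apply: eq_card => y'.
rewrite unfold_in; apply/idP/imsetP => [Sy|[s Ss ->]]; last by rewrite addrC addKr.
by exists (y' - y) => //; rewrite addrC subrK.
Qed.

(** Each x in the inner set carries both (x, y) and (x, y'), so a pair x, x' from it closes up a
    rectangle. *)
Definition grid_rectangles (E : {set F * F}) : nat :=
  (\sum_y \sum_(y' | (y' - y)%R \in S)
     cayley_pairs [set x | ((x, y) \in E) && ((x, y') \in E)])%N.

Definition column_pairs (E : {set F * F}) : nat :=
  (\sum_y \sum_(y' | (y' - y)%R \in S)
     #|[set x | ((x, y) \in E) && ((x, y') \in E)]|)%N.

(** Double counting: vertical pairs are sorted by their two heights or by their column. *)
Lemma column_pairsE (E : {set F * F}) :
  column_pairs E = (\sum_x cayley_pairs [set y | (x, y) \in E])%N.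
Proof.
rewrite /cayley_pairs; under [RHS]eq_bigr do rewrite big_mkcond /=.
rewrite exchange_big; apply: eq_bigr => y _ /=.
under eq_bigr do rewrite -sum1_card big_mkcond /=.
rewrite exchange_big; apply: eq_bigr => x _ /=.
rewrite inE; case: ifP => xy; last first.
  by rewrite big1 // => y' _; rewrite inE xy.
rewrite big_mkcond [RHS]big_mkcond; apply: eq_bigr => y' _ /=.
by rewrite !inE xy /=; do 2!case: ifP.
Qed.

Lemma sum_columns (E : {set F * F}) :
  (\sum_x #|[set y | (x, y) \in E]| = #|E|)%N.
Proof.
rewrite -[RHS]sum1_card [RHS]big_mkcond /=.
under eq_bigr do rewrite -sum1_card big_mkcond /=.
rewrite pair_bigA; apply: eq_bigr => -[x y] _ /=.
by rewrite inE.
Qed.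

(** Sum the Cayley bound over the q columns; by Cauchy-Schwarz their squared sizes total at least
    |E|^2 / q. *)
Lemma column_pairs_ge (E : {set F * F}) :
  #|E|%:R * (#|S|%:R * #|E|%:R / q%:R ^+ 2 - r) <= (column_pairs E)%:R :> K.
Proof.
have q0 := card_field_gt0 F K.
rewrite column_pairsE natr_sum.
apply: le_trans (ler_sum _ (fun x _ => cayley_pairs_ge _)).
rewrite sumrB -2!mulr_sumr -natr_sum sum_columns.

have := sqr_sum_le [set: F] (fun x => #|[set y | (x, y) \in E]|%:R : K).
have eT (h : F -> K) : \sum_(x in [set: F]) h x = \sum_x h x.
  by apply: eq_bigl => x; rewrite inE.
rewrite !eT -natr_sum sum_columns cardsT => h.
rewrite mulrBr [r * _]mulrC lerB //.
have -> : #|E|%:R * (#|S|%:R * #|E|%:R / q%:R ^+ 2) =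
    #|S|%:R / q%:R * (#|E|%:R ^+ 2 / q%:R) :> K by field; rewrite gt_eqF.
apply: ler_wpM2l; first by rewrite divr_ge0 ?ler0n.
by rewrite ler_pdivrMr // mulrC.
Qed.

(** The same argument for the common parts [G p], now with Cauchy-Schwarz over the q |S| pairs of
    heights in [D]. *)
Lemma grid_rectangles_ge_column_pairs (E : {set F * F}) :
  (column_pairs E)%:R * ((column_pairs E)%:R / q%:R ^+ 2 - r)
    <= (grid_rectangles E)%:R :> K.
Proof.
have q0 := card_field_gt0 F K.
pose D := [set p : F * F | p.2 - p.1 \in S].
pose G (p : F * F) := [set x | ((x, p.1) \in E) && ((x, p.2) \in E)].
have sumD (h : F * F -> nat) :
    (\sum_y \sum_(y' | (y' - y)%R \in S) h (y, y') = \sum_(p in D) h p)%N.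
  by rewrite pair_big_dep /=; apply: eq_big => [[y y']|[y y'] _] //=; rewrite inE.
have eC : column_pairs E = (\sum_(p in D) #|G p|)%N by rewrite -sumD.
have eN : grid_rectangles E = (\sum_(p in D) cayley_pairs (G p))%N by rewrite -sumD.
have cD : #|D| = (q * #|S|)%N.
  by rewrite -cayley_edges (sumD (fun=> 1%N)) sum1_card.
rewrite eN natr_sum; apply: le_trans (ler_sum _ (fun p _ => cayley_pairs_ge _)).
rewrite sumrB -2!mulr_sumr -natr_sum -eC.
have := sqr_sum_le D (fun p => #|G p|%:R : K).
rewrite -natr_sum -eC cD => h.
rewrite mulrBr [r * _]mulrC lerB //.
have m0 : 0 < #|S|%:R :> K by rewrite ltr0n.
rewrite mulrA ler_pdivrMr ?exprn_gt0 // -expr2; apply: le_trans h _.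
rewrite natrM le_eqVlt; apply/orP; left; apply/eqP; field.
by rewrite gt_eqF.
Qed.

(** The bound on [r] makes each of the two error terms at most half of its main term, whence the
    factor 8. *)
Lemma grid_rectangles_ge (delta : K) (E : {set F * F}) :
  0 < delta <= 1 -> delta * q%:R ^+ 2 <= #|E|%:R ->
  r <= #|S|%:R * delta ^+ 2 / 4 ->
  #|S|%:R ^+ 2 * #|E|%:R ^+ 4 / (8 * q%:R ^+ 6) <= (grid_rectangles E)%:R :> K.
Proof.
move=> /andP[d0 d1] En r_le; have q0 := card_field_gt0 F K.
apply: le_trans (grid_rectangles_ge_column_pairs E).
have := column_pairs_ge E.
move: En r_le r_ge0 q0; have : 0 < #|S|%:R :> K by rewrite ltr0n.
move: (#|S|%:R : K) (q%:R : K) (#|E|%:R : K) ((column_pairs E)%:R : K).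
move=> m Q n C m0 En r_le r0 Q0 hC.
(* Normalise: [u] is the density of [E], and [v] below is the column pair count over q^2. *)
pose u := n / Q ^+ 2; have eu : n = u * Q ^+ 2.
  by rewrite /u divfK // expf_neq0 // gt_eqF.
have Q2 : 0 < Q ^+ 2 by rewrite exprn_gt0.
have du : delta <= u by rewrite /u ler_pdivlMr.
have u0 : 0 < u by apply: lt_le_trans du.
pose v := C / Q ^+ 2; have ev : C = v * Q ^+ 2.
  by rewrite /v divfK // gt_eqF.
have hv : u * (m * u - r) <= v.
  rewrite /v ler_pdivlMr //; apply: le_trans hC.
  rewrite eu le_eqVlt; apply/orP; left; apply/eqP; field.
  by rewrite gt_eqF.
have r1 : r <= m * u / 2.
  (* Since delta is at most 1, its square is at most delta, hence at most [u]. *)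
  have dd : delta ^+ 2 <= 2 * u by nra.
  by apply: le_trans r_le _; nra.
have hv1 : m * u ^+ 2 / 2 <= v.
  apply: le_trans hv; rewrite -subr_ge0.
  have -> : u * (m * u - r) - m * u ^+ 2 / 2 = u * (m * u / 2 - r) by field.
  by rewrite mulr_ge0 ?subr_ge0 // ltW.
have r2 : r <= v / 2.
  apply: le_trans r_le _.
  have : delta ^+ 2 <= u ^+ 2 by rewrite ler_pXn2r // nnegrE ltW.
  nra.
have -> : m ^+ 2 * n ^+ 4 / (8 * Q ^+ 6) = Q ^+ 2 * ((m * u ^+ 2 / 2) ^+ 2 / 2).
  by rewrite eu; field; rewrite gt_eqF.
have -> : C * (C / Q ^+ 2 - r) = Q ^+ 2 * (v * (v - r)) by rewrite -/v ev; ring.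
have w0 : 0 <= m * u ^+ 2 / 2 by rewrite divr_ge0 // mulr_ge0 ?exprn_ge0 ?ltW.
rewrite ler_pM2l //.
have : (m * u ^+ 2 / 2) ^+ 2 <= v ^+ 2 by rewrite ler_pXn2r ?nnegrE // (le_trans w0).
nra.
Qed.

End Cayley.

(** * Directions on the unit circle, and energy tuples from grid rectangles *)

Section Directions.
Import GRing.Theory.
Local Open Scope ring_scope.
Variable F : finFieldType.
Local Notation q := #|F|.
Hypothesis q_mod4 : (q %% 4 = 3)%N.

Lemma two_neq0 : 2 != 0 :> F.
Proof.
apply/eqP => two0.
have : q%:R = 0 :> F.
  by have := expg_cardG (in_setT (1 : F)); rewrite FinRing.zmodXgE cardsT.
rewrite (divn_eq q 4) q_mod4 natrD natrM.
have -> : 4%:R = 2 * 2 :> F by ring.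
have -> : 3%:R = 2 + 1 :> F by ring.
by rewrite two0 !mulr0 !add0r => /eqP; rewrite oner_eq0.
Qed.

(** As q is twice an odd number plus 1, t^2 = -1 would give t^q = -t, against t^q = t. *)
Lemma sqrD1_neq0 (t : F) : 1 + t ^+ 2 != 0.
Proof.
apply/eqP => /eqP; rewrite addrC addr_eq0 => /eqP t2.
have := expf_card t; rewrite (divn_eq q 4) q_mod4.
have -> : (q %/ 4 * 4 + 3 = (2 * (q %/ 4 * 2 + 1)).+1)%N by lia.
rewrite exprSr exprM t2 exprD mulnC exprM sqrrN expr1n expr1n expr1 mul1r mulN1r.
move=> /eqP; rewrite -subr_eq0 -opprD oppr_eq0 -mulr2n -mulr_natl mulf_eq0.
rewrite (negPf two_neq0) /= => /eqP t0; move/eqP: t2.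
by rewrite t0 expr0n /= eq_sym oppr_eq0 oner_eq0.
Qed.

Definition unit_circle : {set F * F} := [set e | e.1 ^+ 2 + e.2 ^+ 2 == 1].

Lemma card_unit_circle : (q <= #|unit_circle|)%N.
Proof.
(* Stereographic parametrization from (-1, 0), defined for every t because -1 is not a square. *)
pose f (t : F) := ((1 - t ^+ 2) / (1 + t ^+ 2), 2 * t / (1 + t ^+ 2)).
have f_inj : injective f.
  apply: (can_inj (g := fun e => e.2 / (1 + e.1))) => t /=.
  have h := sqrD1_neq0 t; have h2 := two_neq0.
  have -> : 1 + (1 - t ^+ 2) / (1 + t ^+ 2) = 2 / (1 + t ^+ 2) by field.
  by field; rewrite h h2.
rewrite -(card_imset predT f_inj); apply/subset_leq_card/subsetP => _ /imsetP[t _ ->].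
rewrite inE /=; apply/eqP; field; exact: sqrD1_neq0.
Qed.

(* One of each two opposite points of the circle, hence each direction once. *)
Definition half_circle : {set F * F} :=
  [set e in unit_circle | enum_rank e < enum_rank (- e.1, - e.2)]%N.

Lemma card_half_circle : (q <= 2 * #|half_circle|)%N.
Proof.
apply: leq_trans card_unit_circle _.
pose opp (e : F * F) := (- e.1, - e.2).
apply: (@leq_trans #|half_circle :|: opp @: half_circle|).
  apply/subset_leq_card/subsetP => e eC.
  have oppK : opp (opp e) = e by rewrite /opp /= !opprK; case: (e).
  rewrite in_setU inE eC /=; case: ltngtP => //= [lt|/val_inj/enum_rank_inj].
    apply/imsetP; exists (opp e); last by rewrite oppK.
    rewrite !inE /= !sqrrN !opprK; apply/andP; split; first by rewrite inE in eC.
    by case: (e) lt.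
  case: (e) eC => x y; rewrite inE /= => eC [hx hy].
  have z0 (z : F) : z = - z -> z = 0.
    move=> /eqP; rewrite -subr_eq0 opprK -mulr2n -mulr_natl mulf_eq0.
    by rewrite (negPf two_neq0) => /eqP.
  by move: eC; rewrite (z0 x hx) (z0 y hy) expr0n addr0 eq_sym oner_eq0.
apply: leq_trans (leq_card_setU _ _).1 _.
by rewrite mul2n -addnn leq_add2l leq_imset_card.
Qed.

(** Comparing squared lengths gives s' = s or s' = -s; the second makes the points opposite, and
    only one of them is in the half circle. *)
Lemma half_circle_proportional (e e' : F * F) (s s' : F) :
  e \in half_circle -> e' \in half_circle -> s != 0 ->
  s * e.1 = s' * e'.1 -> s * e.2 = s' * e'.2 -> e = e'.
Proof.
rewrite !inE => /andP[/eqP eC lt] /andP[/eqP eC' lt'] s0 h1 h2.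
have : s ^+ 2 == s' ^+ 2.
  rewrite -[_ ^+ 2]mulr1 -{}eC -[s' ^+ 2]mulr1 -{}eC' !mulrDr -!exprMn.
  by rewrite h1 h2.
rewrite eqf_sqr => /orP[] /eqP ss.
  move: h1 h2; rewrite -ss => /(mulfI s0) h1 /(mulfI s0) h2.
  by case: e e' h1 h2 {eC eC' lt lt'} => ? ? [? ?] /= -> ->.
have opp z : s' * z = s * - z by rewrite ss mulNr mulrN opprK.
move: h1 h2; rewrite !opp => /(mulfI s0) h1 /(mulfI s0) h2.
move: lt lt'; rewrite h1 h2 !opprK.
have -> : e = (- e'.1, - e'.2) by case: e h1 h2 {eC} => ? ? /= -> ->.
by case: (e') => x y /= lt lt'; have := ltn_trans lt lt'; rewrite ltnn.
Qed.

(* The point of the paraboloid above [p.1 * e + p.2 * e'], where [e'] is [e]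
   turned by a right angle. *)
Definition lift (e p : F * F) : pt F :=
  let v := (p.1 * e.1 - p.2 * e.2, p.1 * e.2 + p.2 * e.1) in
  (v, v.1 ^+ 2 + v.2 ^+ 2).

Lemma lift_inj e : e \in unit_circle -> injective (lift e).
Proof.
rewrite inE => /eqP eC.
(* The inverse takes dot products with [e] and with its quarter turn, an orthonormal basis. *)
apply: (can_inj (g := fun v : pt F =>
  (v.1.1 * e.1 + v.1.2 * e.2, v.1.2 * e.1 - v.1.1 * e.2))) => -[x y] /=.
by congr pair; rewrite -[RHS]mulr1 -eC; ring.
Qed.

Lemma card_lift_preim (e : F * F) (X : {set pt F}) :
  e \in unit_circle -> X \subset paraboloid F -> #|lift e @^-1: X| = #|X|.
Proof.
move=> eC XP; rewrite -(card_imset _ (lift_inj eC)); congr #|pred_of_set _|.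
apply/setP => -[[v w] z]; apply/imsetP/idP => [[p]|vX]; first by rewrite inE => ? ->.
have h : (v, w, z) = lift e (v * e.1 + w * e.2, w * e.1 - v * e.2).
  have /subsetP/(_ _ vX) := XP; rewrite inE /= => /eqP ->.
  move: eC; rewrite inE => /eqP eC; rewrite /lift /=.
  have -> : (v * e.1 + w * e.2) * e.1 - (w * e.1 - v * e.2) * e.2 = v.
    by rewrite -[RHS]mulr1 -eC; ring.
  have -> // : (v * e.1 + w * e.2) * e.2 + (w * e.1 - v * e.2) * e.1 = w.
  by rewrite -[RHS]mulr1 -eC; ring.
by eexists; last exact: h; rewrite inE -h.
Qed.

Variable A : {group {unit F}}.

Definition subgroup_elts : {set F} := [set l | in_subgroup A l].

Lemma subgroup_eltsP (l : F) : reflect (exists2 u, u \in A & val u = l) (l \in subgroup_elts).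
Proof.
rewrite inE; apply: (iffP existsP) => [[u /andP[Au /eqP <-]]|[u Au <-]]; exists u => //.
by rewrite Au eqxx.
Qed.

Lemma card_subgroup_elts : #|subgroup_elts| = #|A|.
Proof.
rewrite -(card_imset A (@val_inj _ _ {unit F})); congr #|pred_of_set _|.
apply/setP => l; apply/subgroup_eltsP/imsetP => -[u Au]; first by exists u.
by move=> ->; exists u.
Qed.

Lemma subgroup_elts0 : 0 \notin subgroup_elts.
Proof.
apply/subgroup_eltsP => -[u _ u0].
by have := valP u; rewrite /= u0 unitr0.
Qed.

Lemma subgroup_eltsM (b s : F) :
  b \in subgroup_elts -> (b * s \in subgroup_elts) = (s \in subgroup_elts).
Proof.
move=> /subgroup_eltsP[u Au <-]; apply/subgroup_eltsP/subgroup_eltsP => -[v Av].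
  move=> h; exists (u^-1 * v)%g; first by rewrite groupM ?groupV.
  by rewrite /= h mulKr // (valP u).
by move=> <-; exists (u * v)%g; first by rewrite groupM.
Qed.

Lemma subgroup_elts_sqr (s : F) : s \in subgroup_elts -> in_subgroup A (s ^+ 2).
Proof. by move=> sS; have := sS; rewrite -(subgroup_eltsM s sS) inE. Qed.

Variable X : {set pt F}.
Local Notation S := subgroup_elts.

Definition rectangle_params : {set F * F * F * F * F * F} :=
  [set t | let: (e, y, y', x, x') := t in
    [&& e \in half_circle, y' - y \in S, x' - x \in S,
        lift e (x, y) \in X, lift e (x', y') \in X,
        lift e (x', y) \in X & lift e (x, y') \in X]].

Lemma mem_rectangle_params (e : F * F) (y y' x x' : F) :
  ((e, y, y', x, x') \in rectangle_params) =
    [&& e \in half_circle, y' - y \in S, x' - x \in S,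
        lift e (x, y) \in X, lift e (x', y') \in X,
        lift e (x', y) \in X & lift e (x, y') \in X].
Proof. exact: in_set. Qed.

Lemma card_rectangle_params :
  (\sum_(e in half_circle) grid_rectangles S (lift e @^-1: X) = #|rectangle_params|)%N.
Proof.
rewrite -[RHS]sum1_card [RHS]big_mkcond [LHS]big_mkcond /=.
pose f t := (if t \in rectangle_params then 1 else 0)%N.
transitivity (\sum_e \sum_y \sum_y' \sum_x \sum_x' f (e, y, y', x, x'))%N; last first.
  by rewrite !pair_bigA; apply: eq_bigr => -[[[[e y] y'] x] x'].
apply: eq_bigr => e _; rewrite /f; case: ifP => eD; last first.
  by symmetry; do 4!(rewrite big1 // => ? _); rewrite mem_rectangle_params eD.
apply: eq_bigr => y _; rewrite big_mkcond; apply: eq_bigr => y' _.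
case: ifP => Sy; last first.
  by symmetry; do 2!(rewrite big1 // => ? _); rewrite mem_rectangle_params Sy andbF.
rewrite /cayley_pairs big_mkcond; apply: eq_bigr => x _.
rewrite [x \in _]in_set !in_set; case: ifP => hx; last first.
  symmetry; rewrite big1 // => x' _; rewrite mem_rectangle_params; case: ifP => //.
  by case/and5P=> _ _ _ h /and3P[_ _ h']; rewrite h h' in hx.
case/andP: hx => h h'.
rewrite big_mkcond; apply: eq_bigr => x' _.
rewrite mem_rectangle_params eD Sy h h' !inE /= andbT.
by case: in_subgroup; case: (lift e (x', y) \in X); case: (lift e (x', y') \in X).
Qed.

(** Opposite corners come first, because a + b = c + d pairs the ends of the two diagonals. *)
Definition energy_tuple (t : F * F * F * F * F * F) : pt F * pt F * pt F * pt F :=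
  let: (e, y, y', x, x') := t in
  (lift e (x, y), lift e (x', y'), lift e (x', y), lift e (x, y')).

(** The projected side from a to c is the nonzero multiple x' - x of [e], which determines [e] in
    the half circle; then [lift e] is injective. *)
Lemma energy_tuple_inj : {in rectangle_params &, injective energy_tuple}.
Proof.
move=> [[[[e y] y'] x] x'] [[[[f z] z'] w] w'].
rewrite !mem_rectangle_params => /and4P[eD _ Sx _] /andP[fD _] [].
move=> a1 a2 _ b1 b2 _ c1 c2 _ d1 d2 _.
have x0 : x' - x != 0 by apply: contraNneq subgroup_elts0 => <-.
have ef : e = f.
  apply: (half_circle_proportional (s' := w' - w) eD fD x0).
    rewrite (_ : (x' - x) * e.1 = (x' * e.1 - y * e.2) - (x * e.1 - y * e.2)); last by ring.
    by rewrite a1 c1; ring.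
  rewrite (_ : (x' - x) * e.2 = (x' * e.2 + y * e.1) - (x * e.2 + y * e.1)); last by ring.
  by rewrite a2 c2; ring.
have eC : e \in unit_circle by move: eD; rewrite inE => /andP[].
rewrite -{f fD}ef in a1 a2 b1 b2 c1 c2 d1 d2 *.
have [-> ->] : (x, y) = (w, z) by apply: (lift_inj eC); rewrite /lift /= a1 a2.
by have [-> ->] : (x', y') = (w', z') by apply: (lift_inj eC); rewrite /lift /= b1 b2.
Qed.

Lemma energy_tuple_count (t : F * F * F * F * F * F) :
  t \in rectangle_params ->
  let u := energy_tuple t in
  nontrivial_energy X u.1.1.1 u.1.1.2 u.1.2 u.2 &&
  rect_sides_in A u.1.1.1 u.1.1.2 u.1.2 u.2.
Proof.
case: t => [[[[e y] y'] x] x']; rewrite mem_rectangle_params.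
case/and5P=> eD Sy Sx aX /and3P[bX cX dX].
have eC : e \in unit_circle by move: eD; rewrite inE => /andP[].
have eC1 : e.1 ^+ 2 + e.2 ^+ 2 = 1 by move: eC; rewrite inE => /eqP.
have xx : x != x'.
  by apply: contraNneq subgroup_elts0 => xx; rewrite -(subrr x') -{2}xx.
have yy : y != y'.
  by apply: contraNneq subgroup_elts0 => yy; rewrite -(subrr y') -{2}yy.
apply/andP; split; rewrite /=.
  rewrite /nontrivial_energy aX bX cX dX !(inj_eq (lift_inj eC)) !xpair_eqE /=.
  rewrite ![x' == x]eq_sym ![y' == y]eq_sym (negPf xx) (negPf yy) !eqxx /= andbT.
  by apply/andP; split; first (apply/andP; split); apply/eqP; ring.
(* This product is the side length; [e] has norm 1, and squares of elements of [A] stay in [A]. *)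
have sx : in_subgroup A ((x' - x) ^+ 2 * (e.1 ^+ 2 + e.2 ^+ 2)).
  by rewrite eC1 mulr1 subgroup_elts_sqr.
have sy : in_subgroup A ((y' - y) ^+ 2 * (e.1 ^+ 2 + e.2 ^+ 2)).
  by rewrite eC1 mulr1 subgroup_elts_sqr.
rewrite /rect_sides_in /is_rectangle /base /len2 /dot2 /sub2 /lift /=.
apply/andP; split; first by apply/and4P; split; apply/eqP; ring.
apply/and4P; split.
- by move: sx; congr in_subgroup; ring.
- by move: sy; congr in_subgroup; ring.
- by move: sx; congr in_subgroup; ring.
- by move: sy; congr in_subgroup; ring.
Qed.

Lemma count_rect_energy_ge :
  (\sum_(e in half_circle) grid_rectangles S (lift e @^-1: X) <= count_rect_energy X A)%N.
Proof.
rewrite card_rectangle_params -(card_in_imset energy_tuple_inj).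
apply/subset_leq_card/subsetP => _ /imsetP[t tP ->].
by rewrite inE; exact: energy_tuple_count.
Qed.

End Directions.

(** * Summation over directions, in any ordered field *)

Section Count.
Import Order.TTheory GRing.Theory Num.Theory.
Local Open Scope ring_scope.

Lemma count_rect_energy_lower_bound (K : realFieldType) (r delta : K)
    (F : finFieldType) (A : {group {unit F}}) (X : {set pt F}) :
  (#|F| %% 4 = 3)%N -> X \subset paraboloid F ->
  0 <= r -> #|F|%:R <= r ^+ 2 -> 0 < delta <= 1 ->
  delta * #|F|%:R ^+ 2 <= #|X|%:R -> r <= #|A|%:R * delta ^+ 2 / 4 ->
  #|X|%:R ^+ 4 * #|A|%:R ^+ 2 / (16 * #|F|%:R ^+ 5) <= (count_rect_energy X A)%:R :> K.
Proof.
move=> q4 XP r0 q_le d01 Xn r_le; have Q0 := card_field_gt0 F K.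
have := count_rect_energy_ge A X; rewrite -(ler_nat K); apply: le_trans.
pose B : K := #|A|%:R ^+ 2 * #|X|%:R ^+ 4 / (8 * #|F|%:R ^+ 6).
have A0 : (0 < #|subgroup_elts A|)%N by rewrite card_subgroup_elts cardG_gt0.
rewrite natr_sum; apply: (@le_trans _ _ (\sum_(e in half_circle F) B)); last first.
  apply: ler_sum => e; rewrite inE => /andP[eC _].
  have := @grid_rectangles_ge F _ (subgroup_elts0 A) A0 (@subgroup_eltsM F A)
    K r r0 q_le delta (lift e @^-1: X) d01.
  by rewrite card_subgroup_elts (card_lift_preim eC XP); apply.
rewrite sumr_const -[B *+ _]mulr_natl.
have := card_half_circle q4; rewrite -(ler_nat K) natrM.
have B0 : 0 <= B by rewrite divr_ge0 ?mulr_ge0 ?exprn_ge0 ?ler0n.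
(* At least q / 2 directions contribute [B] each, turning 8 q^6 into 16 q^5. *)
move=> h; apply: (@le_trans _ _ (#|F|%:R / 2 * B)); last by apply: ler_wpM2r => //; lra.
rewrite le_eqVlt; apply/orP; left; apply/eqP; rewrite /B; field.
by rewrite gt_eqF.
Qed.

End Count.

(* The real-valued statement and the choice of the threshold *)
From mathcomp Require Import Rstruct.
From Stdlib Require Import Reals Lra.

(** Split the exponent 2/3 as 1/2 + 1/6; the sixth root of [Q] is at least [M]. *)
Lemma sqrt_le_Rpower (M Q : R) :
  (0 < M)%R -> (M ^ 6 <= Q)%R -> (sqrt Q * M <= Rpower Q (2 / 3))%R.
Proof.
move=> M0 MQ; have M6 : (0 < M ^ 6)%R by apply: pow_lt.
have Q0 : (0 < Q)%R by apply: Rlt_le_trans MQ.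
have -> : (2 / 3 = / 2 + / 6)%R by field.
rewrite Rpower_plus Rpower_sqrt //; apply: Rmult_le_compat_l; first exact: sqrt_pos.
have -> : M = Rpower (M ^ 6) (/ 6).
  rewrite -Rpower_pow // Rpower_mult.
  have -> : (INR 6 * / 6 = 1)%R by rewrite /=; field.
  by rewrite Rpower_1.
by apply: Rle_Rpower_l; [Lra.lra|split].
Qed.

Theorem theorem1p6 :
  exists c : R, (0 < c)%R /\
  forall delta : R, (0 < delta <= 1)%R ->
  exists q0 : nat,
  forall (F : finFieldType) (A : {group {unit F}}) (X : {set pt F}),
    let q := #|F| in
    q %% 4 = 3 ->
    (Rpower (INR q) (2 / 3) <= INR #|A|)%R ->
    q0 <= q ->
    X \subset paraboloid F ->
    (delta * INR q ^ 2 <= INR #|X|)%R ->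
    (c * (INR #|X| ^ 4 * INR #|A| ^ 2) / INR q ^ 5
       <= INR (count_rect_energy X A))%R.
Proof.
exists (/ 16)%R; split; first Lra.lra.
(* With this [M], the bound sqrt q * M <= |A| is the required sqrt q <= |A| delta^2 / 4; it holds
   once q is at least M^6. *)
move=> delta [d0 d1]; set M := (4 / delta ^ 2)%R.
have d2 : (0 < delta ^ 2)%R by apply: pow_lt.
have M0 : (0 < M)%R by apply: Rdiv_lt_0_compat; Lra.lra.
have [q0 q0M] := INR_unbounded (M ^ 6).
exists q0 => F A X q q4 qA qq0 XP Xn.
have MQ : (M ^ 6 <= INR q)%R.
  by apply: Rle_trans (Rlt_le _ _ q0M) _; apply: le_INR; apply/leP.
have Q0 : (0 < INR q)%R by apply: Rlt_le_trans MQ; apply: pow_lt.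
have r_le : (sqrt (INR q) <= INR #|A| * delta ^ 2 / 4)%R.
  have h := Rle_trans _ _ _ (sqrt_le_Rpower M0 MQ) qA.
  have -> : sqrt (INR q) = (sqrt (INR q) * M * (delta ^ 2 / 4))%R.
    by rewrite /M; field; Lra.lra.
  have -> : (INR #|A| * delta ^ 2 / 4 = INR #|A| * (delta ^ 2 / 4))%R by field.
  by apply: Rmult_le_compat_r h; Lra.lra.
have -> : (/ 16 * (INR #|X| ^ 4 * INR #|A| ^ 2) / INR q ^ 5 =
           INR #|X| ^ 4 * INR #|A| ^ 2 / (16 * INR q ^ 5))%R by field; Lra.lra.
have IZR_INR4 : (4 = INR 4)%R by rewrite /=; ring.
have IZR_INR16 : (16 = INR 16)%R by rewrite /=; ring.
apply/RleP; rewrite IZR_INR16 !RealsE.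
apply: (@count_rect_energy_lower_bound R (sqrt (INR q)) delta) => //.
- by apply/RleP; apply: sqrt_pos.
- by rewrite -INRE -RpowE; apply/RleP; rewrite pow2_sqrt; [apply: Rle_refl|Lra.lra].
- by apply/andP; split; [apply/RltP|apply/RleP].
- by apply/RleP; move: Xn; rewrite !RealsE.
- by apply/RleP; move: r_le; rewrite IZR_INR4 !RealsE.
Qed.
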